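(* Let $G$ be a connected graph with at least $3$ vertices such that $T_2(G)$ is well-covered. If $x_1,x_2,x_3$ are vertices of $G$ forming an induced path $x_1x_2x_3$ in $G$, then either these three vertices lie on a common $4$-cycle of $G$, or at least one of $x_1,x_2,x_3$ lies on a $3$-cycle of $G$.
   Context: The $2$-token graph $T_2(G)$ has as vertices the $2$-subsets of $V(G)$, two of them adjacent if their symmetric difference is an edge of $G$. A graph is well-covered if all of its maximal (with respect to inclusion) independent sets have the same cardinality. *)

(* Defs.v *)
From mathcomp Require Import all_boot.

Set Implicit Arguments.
Unset Strict Implicit.
Unset Printing Implicit Defensive.

(** Finite simple graphs. *)
Record sgraph := SGraph {
  svertex :> finType;
  sedge : rel svertex;
  sedge_sym : symmetric sedge;
  sedge_irr : irreflexive sedge }.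

Arguments sedge {G} : rename.

Definition edges (G : sgraph) : {set {set G}} :=
  [set A : {set G} | [exists x, exists y, sedge x y && (A == [set x; y])]].

Definition connected_graph (G : sgraph) : Prop :=
  forall x y : G, connect sedge x y.

Definition independent (G : sgraph) (S : {set G}) : bool :=
  [forall x in S, forall y in S, ~~ sedge x y].

Definition well_covered (G : sgraph) : Prop :=
  forall S S' : {set G},
    maxset (@independent G) S -> maxset (@independent G) S' -> #|S| = #|S'|.

Definition induced_path3 (G : sgraph) (x1 x2 x3 : G) : bool :=
  [&& uniq [:: x1; x2; x3], sedge x1 x2, sedge x2 x3 & ~~ sedge x1 x3].

(** [c] lists, in cyclic order, the vertices of a (not necessarily induced)
    [n]-cycle; this is the graph-theoretic notion only for [n >= 3]. *)
Definition ncycle (G : sgraph) (n : nat) (c : seq G) : Prop :=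
  size c = n /\ ucycle sedge c.

Definition symdiff (T : finType) (A B : {set T}) : {set T} :=
  (A :\: B) :|: (B :\: A).

Section TokenGraph.
Variable G : sgraph.

Definition token2 : finType := {A : {set G} | #|A| == 2}.

Definition token2_adj : rel token2 :=
  fun A B => symdiff (val A) (val B) \in edges G.

Lemma token2_adj_sym : symmetric token2_adj.
Proof. by move=> A B; rewrite /token2_adj /symdiff setUC. Qed.

Lemma token2_adj_irr : irreflexive token2_adj.
Proof.
move=> A; rewrite /token2_adj /symdiff setDv setU0 inE.
apply/negbTE/negP => /existsP[x /existsP[y /andP[_ /eqP/setP eq0]]].
move: (eq0 x).
by rewrite !inE eqxx.
Qed.

Definition T2 : sgraph := SGraph token2_adj_sym token2_adj_irr.

End TokenGraph.

(* Main.v *)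
Require Import Defs.
From mathcomp Require Import all_boot.

(** Suppose the theorem fails for the induced path [x1 x2 x3], and let
    [X = {x1, x2, x3}]. In [T2 G] let [I] consist of the pair [{x1, x3}] and all
    edges of [G] with exactly one end in [X]. Two adjacent members of [I] would
    give a triangle meeting [X] or a second common neighbour of [x1] and [x3], so
    [I] is independent. Moreover [I] dominates every neighbour, other than [{x1, x3}], of [{x1, x2}] and
    of [{x2, x3}]: such a neighbour is [{a, c}] with [{a, b}] an edge inside [X],
    [b] adjacent to [c] and [c] outside [X], hence it is adjacent to [{b, c}].
    Therefore, in any maximal independent set containing [I], the vertex
    [{x1, x3}] can be exchanged for the two vertices [{x1, x2}] and [{x2, x3}],
    which contradicts well-coveredness. *)

Set Implicit Arguments.
Unset Strict Implicit.
Unset Printing Implicit Defensive.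

Lemma independentP (H : sgraph) (S : {set H}) :
  reflect {in S &, forall x y, ~~ sedge x y} (independent S).
Proof.
apply: (iffP forall_inP) => [indS x y xS yS | indS x xS].
  exact: (forall_inP (indS x xS)).
by apply/forall_inP => y; exact: indS.
Qed.

(** Extend [I] to a maximal independent set [S]. Domination by [I] keeps out of [S] every neighbour
    of [p] or [r] except [q], so trading [q] for both [p] and [r] leaves an independent set with one
    more element, and any maximal extension of it is larger than [S]. *)
Lemma well_covered_no_exchange (H : sgraph) (p q r : H) (I : {set H}) :
    well_covered H -> independent I -> q \in I ->
    p != r -> ~~ sedge p r -> sedge p q -> sedge r q ->
  ~ (forall n, sedge p n || sedge r n -> n != q ->
       exists2 m, m \in I & sedge n m).
Proof.
move=> wc indI qI neq_pr npr pq rq dom.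
have [S maxS sIS] := maxset_exists indI.
have /independentP indS := maxsetp maxS.
have domS n : sedge p n || sedge r n -> n != q -> n \notin S.
  move=> adj neq; have [m mI nm] := dom n adj neq; apply/negP => nS.
  by have := indS n m nS (subsetP sIS m mI); rewrite nm.
have qS : q \in S := subsetP sIS q qI.
have pS : p \notin S by apply/negP => pS; have := indS p q pS qS; rewrite pq.
have rS : r \notin S by apply/negP => rS; have := indS r q rS qS; rewrite rq.
pose S' := p |: (r |: S :\ q).
have cardS' : #|S'| = #|S|.+1.
  rewrite !cardsU1 (cardsD1 q S) qS !inE negb_or neq_pr.
  by rewrite (negbTE pS) (negbTE rS) !andbF.
have indS' : independent S'.
  apply/independentP => x y; rewrite !inE.
  case/or3P => [/eqP->|/eqP->|/andP[xq xS]];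
    case/or3P => [/eqP->|/eqP->|/andP[yq yS]]; rewrite ?sedge_irr //.
  - by apply: contraL yS => py; apply: domS; rewrite ?py.
  - by rewrite sedge_sym.
  - by apply: contraL yS => ry; apply: domS; rewrite ?ry ?orbT.
  - by apply: contraL xS => xp; apply: domS; rewrite // sedge_sym xp.
  - by apply: contraL xS => xr; apply: domS; rewrite // orbC sedge_sym xr.
  - exact: indS.
have [M maxM sS'M] := maxset_exists indS'.
by have := subset_leq_card sS'M; rewrite cardS' (wc _ _ maxS maxM) ltnn.
Qed.

(** Equal cardinalities force both one-sided differences to have the same size, hence size 1, so
    exactly one element is shared. *)
Lemma symdiff_card2 (T : finType) (A B : {set T}) :
    #|A| = 2 -> #|B| = 2 -> #|symdiff A B| = 2 ->
  exists a b c, [/\ symdiff A B = [set b; c], A = [set a; b], B = [set a; c],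
                   a != b & a != c].
Proof.
move=> cA cB cD.
have eA := cardsID B A; have eB := cardsID A B.
have dAB : [disjoint A :\: B & B :\: A].
  rewrite -setI_eq0; apply/eqP/setP => x; rewrite !inE.
  by case: (x \in A) (x \in B) => [] [].
have eD : #|A :\: B| + #|B :\: A| = 2.
  by rewrite -cD; apply/esym/eqP; rewrite (leq_card_setU _ _).2.
rewrite cA in eA; rewrite cB setIC in eB.
have eqD : #|A :\: B| = #|B :\: A|.
  by apply/eqP; rewrite -(eqn_add2l #|A :&: B|) eA eB.
have c1 : #|B :\: A| = 1.
  by move: eD; rewrite eqD addnn; case: #|_| => [|[|]].
have c2 : #|A :\: B| = 1 by rewrite eqD.
have c3 : #|A :&: B| = 1 by move: eA; rewrite c2 addn1 => -[].
have /cards1P[c sC] : #|B :\: A| == 1 by rewrite c1.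
have /cards1P[b sB] : #|A :\: B| == 1 by rewrite c2.
have /cards1P[a sA] : #|A :&: B| == 1 by rewrite c3.
have: b \in A :\: B by rewrite sB set11.
have: c \in B :\: A by rewrite sC set11.
have: a \in A :&: B by rewrite sA set11.
rewrite !inE => /andP[aA aB] /andP[cnA _] /andP[bnB _].
exists a, b, c; split.
- by rewrite /symdiff sB sC.
- by rewrite -(setID A B) sA sB.
- by rewrite -(setID B A) setIC sA sC.
- by apply: contraNneq bnB => <-.
- by apply: contraNneq cnA => <-.
Qed.

Section TokenAdjacency.
Variable G : sgraph.
Implicit Types a b c : G.

Lemma mem_edges a b : ([set a; b] \in edges G) = sedge a b.
Proof.
rewrite inE; apply/existsP/idP => [[x /existsP[y /andP[xy /eqP/setP eqS]]]|ab].
  have nxy : x != y by apply: contraTneq xy => ->; rewrite sedge_irr.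
  have := eqS x; have := eqS y; rewrite !inE !eqxx orbT /=.
  case/orP => /eqP ya; case/orP => /eqP xb; subst => //.
  - by rewrite eqxx in nxy.
  - by rewrite sedge_sym.
  - by rewrite eqxx in nxy.
by exists a; apply/existsP; exists b; rewrite ab eqxx.
Qed.

(** The token-sliding view of adjacency: one token rests on [a] while the other moves along the edge
    [bc]. *)
Lemma token2_adjP (A B : T2 G) :
  reflect (exists a b c, [/\ sedge b c, val A = [set a; b], val B = [set a; c],
                           a != b & a != c])
          (sedge A B).
Proof.
apply: (iffP idP) => [|[a [b [c [bc eA eB ab ac]]]]]; last first.
  rewrite /sedge /= /token2_adj /symdiff eA eB.
  have nbc : b != c by apply: contraTneq bc => ->; rewrite sedge_irr.
  suff -> : [set a; b] :\: [set a; c] :|: [set a; c] :\: [set a; b] = [set b; c].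
    by rewrite mem_edges.
  apply/setP => x; rewrite !inE.
  case: (eqVneq x a) => [->|_] /=; first by rewrite (negbTE ab) (negbTE ac).
  by case: (eqVneq x b) => [->|_] /=; rewrite ?(negbTE nbc) //; case: (x == c).
move=> adj; have {}adj : symdiff (val A) (val B) \in edges G := adj.
have cD : #|symdiff (val A) (val B)| = 2.
  move: adj; rewrite inE => /existsP[x /existsP[y /andP[xy /eqP->]]].
  rewrite cards2; suff -> : x != y by [].
  by apply: contraTneq xy => ->; rewrite sedge_irr.
have [a [b [c [eD eA eB ab ac]]]] :=
  symdiff_card2 (eqP (valP A)) (eqP (valP B)) cD.
by exists a, b, c; split=> //; rewrite -mem_edges -eD.
Qed.

Lemma set2_eq_inv a b c d : [set a; b] = [set c; d] ->
  a != b -> (a = c /\ b = d) \/ (a = d /\ b = c).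
Proof.
move=> /setP eqS ab; have := eqS a; have := eqS b.
rewrite !inE !eqxx orbT /= => /esym/orP[]/eqP eb /esym/orP[]/eqP ea.
- by rewrite ea eb eqxx in ab.
- by right.
- by left.
- by rewrite ea eb eqxx in ab.
Qed.

Lemma ncycle3 a b c : sedge a b -> sedge b c -> sedge c a ->
  ncycle 3 [:: a; b; c].
Proof.
move=> ab bc ca; split=> //; rewrite /ucycle /= ab bc ca /= !inE !andbT negb_or.
rewrite -andbA; apply/and3P; split.
  by apply: contraTneq ab => ->; rewrite sedge_irr.
  by apply: contraTneq ca => ->; rewrite sedge_irr.
by apply: contraTneq bc => ->; rewrite sedge_irr.
Qed.

Lemma mk_token2 a b : a != b -> {A : T2 G | val A = [set a; b]}.
Proof.
move=> ab; have cab : #|[set a; b]| == 2 by rewrite cards2 ab.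
by exists (exist _ [set a; b] cab).
Qed.

End TokenAdjacency.

Theorem theorem5p1 (G : sgraph) (hconn : connected_graph G) (hcard : 3 <= #|G|)
    (hwc : well_covered (T2 G)) (x1 x2 x3 : G) (hpath : induced_path3 x1 x2 x3) :
  (exists c : seq G, ncycle 4 c /\ [/\ x1 \in c, x2 \in c & x3 \in c]) \/
  (exists c : seq G, ncycle 3 c /\ [\/ x1 \in c, x2 \in c | x3 \in c]).
Proof.
case/and4P: hpath => /= /and3P[]; rewrite !inE negb_or.
move=> /andP[n12 n13] n23 _ e12 e23 ne13.
pose X := [set x1; x2; x3].
case: (boolP [exists a in X, exists b, exists c,
                [&& sedge a b, sedge b c & sedge c a]]) => [|no3].
  case/exists_inP => a aX /existsP[b /existsP[c /and3P[ab bc ca]]].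
  right; exists [:: a; b; c]; split; first exact: ncycle3.
  by move: aX; rewrite !inE -orbA => /or3P[]/eqP->; rewrite eqxx;
     [constructor 1 | constructor 2 | constructor 3].
have {}no3 a b c : a \in X -> sedge a b -> sedge b c -> sedge c a -> False.
  move=> aX ab bc ca; case/negP: no3; apply/exists_inP; exists a => //.
  by apply/existsP; exists b; apply/existsP; exists c; rewrite ab bc.
(* [x2] is already a common neighbour of [x1] and [x3]; a second one closes a 4-cycle. *)
case: (boolP [exists c, [&& c \notin X, sedge x1 c & sedge x3 c]]) => [|no4].
  case/existsP => c /and3P[]; rewrite !inE !negb_or -andbA.
  move=> /and3P[c1 c2 c3] e1 e3; left; exists [:: x1; x2; x3; c].
  split; last by rewrite !inE !eqxx !orbT.
  split=> //; rewrite /ucycle /= e12 e23 e3 (sedge_sym c) e1 !inE !negb_or.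
  by rewrite n12 n13 n23 !(eq_sym _ c) c1 c2 c3.
have {}no4 c : c \notin X -> sedge x1 c -> sedge x3 c -> False.
  by move=> cX e1 e3; case/existsP: no4; exists c; rewrite cX e1.
exfalso.
have [q eq] := mk_token2 n13.
have [p ep] := mk_token2 n12.
have [r er] := mk_token2 n23.
pose I : {set T2 G} := [set A | (A == q) ||
  [exists u in X, exists v, [&& v \notin X, sedge u v & val A == [set u; v]]]].
have inIP (A : T2 G) : A \in I -> A = q \/
    exists u v, [/\ u \in X, v \notin X, sedge u v & val A = [set u; v]].
  rewrite inE => /orP[/eqP->|]; first by left.
  case/exists_inP => u uX /existsP[v /and3P[vX uv /eqP eA]].
  by right; exists u, v.
have mem_I u v (A : T2 G) : u \in X -> v \notin X -> sedge u v ->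
    val A = [set u; v] -> A \in I.
  move=> uX vX uv eA; rewrite inE; apply/orP; right; apply/exists_inP.
  by exists u => //; apply/existsP; exists v; rewrite vX uv eA eqxx.
have x1X : x1 \in X by rewrite !inE eqxx.
have x2X : x2 \in X by rewrite !inE eqxx orbT.
have x3X : x3 \in X by rewrite !inE eqxx orbT.
have q_nonadj (B : T2 G) : B \in I -> ~~ sedge q B.
  move=> BI; apply/negP => adj; case: (inIP B BI) => [eBq|[u [v [uX vX uv eB]]]].
    by rewrite eBq sedge_irr in adj.
  case/token2_adjP: adj => a [b [c [bc eA eB' ab ac]]].
  rewrite eq in eA; rewrite eB in eB'.
  have uv' : u != v by apply: contraNneq vX => <-.
  (* The resting vertex [a] is [x1] or [x3]. It cannot be [v], which is outside [X]; so it is [u],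
     and [c = v] is adjacent to both [x1] and [x3]. *)
  case: (set2_eq_inv eA n13) => -[ea eb]; subst a b;
    case: (set2_eq_inv eB' uv') => -[eu ev]; subst u v.
  - exact: (no4 c).
  - by rewrite x1X in vX.
  - by apply: (no4 c) => //.
  - by rewrite x3X in vX.
have indI : independent I.
  apply/independentP => A B AI BI; apply/negP => adj.
  case: (inIP A AI) => [eAq|[u [v [uX vX uv eA]]]].
    by subst A; have := q_nonadj B BI; rewrite adj.
  case: (inIP B BI) => [eBq|[u' [v' [uX' vX' uv' eB]]]].
    by subst B; have := q_nonadj A AI; rewrite sedge_sym adj.
  case/token2_adjP: adj => a [b [c [bc eA' eB' ab ac]]].
  (* Both pairs are edges of [G], so [a], [b], [c] form a triangle; it meets [X] in [u], which is
     [a] or [b]. *)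
  have eab : sedge a b by rewrite -mem_edges -eA' eA mem_edges.
  have eac : sedge a c by rewrite -mem_edges -eB' eB mem_edges.
  have : u \in [set a; b] by rewrite -eA' eA set21.
  rewrite !inE => /orP[]/eqP eu; subst u.
    by apply: (no3 a b c) => //; rewrite sedge_sym.
  by apply: (no3 b c a) => //; rewrite sedge_sym.
have dom y z (A n : T2 G) : y \in X -> z \in X -> sedge y z ->
    val A = [set y; z] -> sedge A n -> n != q ->
    exists2 m, m \in I & sedge n m.
  move=> yX zX yz eA /token2_adjP[a [b [c [bc eA' en ab ac]]]] nq.
  have eab : sedge a b by rewrite -mem_edges -eA' eA mem_edges.
  have sX : [set a; b] \subset X by rewrite -eA' eA subUset !sub1set yX.
  have aX : a \in X by rewrite (subsetP sX) ?set21.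
  have bX : b \in X by rewrite (subsetP sX) ?set22.
  (* Otherwise [a], [b], [c] exhaust [X]. Since [b] is adjacent to both others and [x1 x3] is not an
     edge, [b] is [x2], which makes [n] equal to [q]. *)
  have cX : c \notin X.
    apply: contraNN nq => cX; apply/eqP/val_inj; rewrite eq en.
    have nbc : b != c by apply: contraTneq bc => ->; rewrite sedge_irr.
    move: aX bX cX eab bc ab ac nbc; rewrite !inE -!orbA.
    case/or3P=> /eqP->; case/or3P=> /eqP->; case/or3P=> /eqP->;
      rewrite ?eqxx ?(negbTE ne13) ?(sedge_sym x3 x1) ?(negbTE ne13) // => *.
    by rewrite setUC.
  have nbc : b != c by apply: contraTneq bc => ->; rewrite sedge_irr.
  (* Keep the token on [c] and slide the other one from [a] back to [b]. *)
  have [m em] := mk_token2 nbc.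
  exists m; first exact: (mem_I b c).
  apply/token2_adjP; exists c, a, b.
  by rewrite en em !(setUC [set c]) !(eq_sym c).
have pq : sedge p q by apply/token2_adjP; exists x1, x2, x3.
have rq : sedge r q.
  apply/token2_adjP; exists x3, x2, x1.
  by rewrite er eq (setUC [set x3]) (setUC [set x3]) sedge_sym !(eq_sym x3).
have pr : p != r.
  apply/eqP => epr; move: er; rewrite -epr ep => /set2_eq_inv /(_ n12).
  by case=> -[/eqP]; rewrite ?(negbTE n12) ?(negbTE n13).
(* The only shared vertex is [x2], so adjacency would need the missing edge [x1 x3]. *)
have npr : ~~ sedge p r.
  apply/negP => /token2_adjP[a [b [c [bc eA eB ab ac]]]].
  rewrite ep in eA; rewrite er in eB.
  case: (set2_eq_inv eA n12) => -[? ?]; case: (set2_eq_inv eB n23) => -[? ?]; subst;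
    rewrite ?eqxx // in n12 n13 n23 ne13 bc *; by rewrite ?bc in ne13.
apply: (well_covered_no_exchange hwc indI _ pr npr pq rq).
  by rewrite inE eqxx.
move=> n /orP[]; [exact: (dom x1 x2)|exact: (dom x2 x3)].
Qed.
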